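(* Let $k\ge 3$ be an integer and let $d(k)=(2k+1)^{8k+4}k^2(k+1)$. Let $G$ be a graph and $c$ a vertex of $G$. Let $X\subseteq V(G)\setminus\{c\}$ be any set of vertices such that $G$ contains no edge cut of size less than $k$ separating $c$ from a vertex in $X$. If a graph $F$ of maximum degree at most $k$ does not appear in $G$ as a strong immersion, then there exist sets $Y\subseteq X$ and $K\subseteq E(G)$ such that $k|Y|+|K|<d(k)|V(F)|$ and the component of $G-Y-K$ that contains $c$ does not contain any vertex of $X$.
   Context: Graphs are finite and may have parallel edges and loops; each loop contributes $2$ to the degree of its vertex. $G-Y-K$ is the graph obtained from $G$ by removing the vertices in $Y$ (with all incident edges) and the edges in $K$. An immersion of a graph $H$ in a graph $G$ is a function $\theta$ on the vertices and edges of $H$ such that: (a) $\theta(v)$ is a vertex of $G$ for each $v\in V(H)$, and $\theta$ restricted to $V(H)$ is injective; (b) $\theta(e)$ is a connected subgraph of $G$ for each $e\in E(H)$, and for distinct $e,f\in E(H)$ the subgraphs $\theta(e)$ and $\theta(f)$ are edge-disjoint; (c) if $e\in E(H)$ is incident with $v\in V(H)$, then $\theta(v)$ is a vertex of $\theta(e)$, and if $e$ is a loop, then $\theta(e)$ contains a cycle passing through $\theta(v)$. The immersion is strong if, in addition, whenever $e\in E(H)$ is not incident with $v\in V(H)$, $\theta(e)$ does not contain $\theta(v)$. ''$F$ appears in $G$ as a strong immersion'' means that there is a strong immersion of $F$ in $G$. *)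

(* Defs.v *)
From mathcomp Require Import all_boot.

Set Implicit Arguments.
Unset Strict Implicit.
Unset Printing Implicit Defensive.

(* Finite undirected multigraphs: the two ends of an edge are listed in an
   arbitrary order, to which every notion below is insensitive; a loop has
   [src e = dst e]. *)
Record mgraph := MGraph {
  vertex : finType;
  edge : finType;
  src : edge -> vertex;
  dst : edge -> vertex }.

Section Graph.
Variable G : mgraph.
Implicit Types (e : edge G) (u v c x : vertex G).

Definition incident e v : bool := (src e == v) || (dst e == v).

Definition is_loop e : bool := src e == dst e.

Definition joins e u v : bool :=
  (src e == u) && (dst e == v) || (src e == v) && (dst e == u).

(* A loop at [v] is counted in both terms. *)
Definition degree v : nat := #|[set e | src e == v]| + #|[set e | dst e == v]|.

Record subgraph := Subgraph {
  sub_V : {set vertex G};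
  sub_E : {set edge G};
  sub_closed : {in sub_E, forall e, (src e \in sub_V) && (dst e \in sub_V)} }.

Implicit Types H : subgraph.

Definition sub_adj H : rel (vertex G) :=
  [rel u v | [exists e in sub_E H, joins e u v]].

Definition sub_connected H : Prop :=
  sub_V H != set0 /\ {in sub_V H &, forall u v, connect (sub_adj H) u v}.

(* [connect] is reflexive on all of [vertex G], hence the restriction to the
   vertices of [H]; the result is empty if [c] is not a vertex of [H]. *)
Definition component H c : {set vertex G} :=
  [set v in sub_V H | (c \in sub_V H) && connect (sub_adj H) c v].

(* The cycle v_0 e_0 v_1 e_1 ... v_(n-1) e_(n-1) v_0 with n >= 1 is encoded as
   the sequence of pairs (v_i, e_i).  Loops (n = 1) and pairs of parallel edges
   (n = 2) are cycles. *)
Definition is_cycle (s : seq (vertex G * edge G)) : bool :=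
  [&& s != [::], uniq [seq p.1 | p <- s], uniq [seq p.2 | p <- s]
    & cycle [rel p q | joins p.2 p.1 q.1] s].

Definition has_cycle_through H v : Prop :=
  exists s : seq (vertex G * edge G),
    [/\ is_cycle s,
        {in s, forall p, (p.1 \in sub_V H) && (p.2 \in sub_E H)}
      & v \in [seq p.1 | p <- s]].

Section Deletion.
Variables (Y : {set vertex G}) (K : {set edge G}).

Definition del_V : {set vertex G} := ~: Y.

Definition del_E : {set edge G} :=
  [set e | [&& e \notin K, src e \notin Y & dst e \notin Y]].

Fact del_subproof :
  {in del_E, forall e, (src e \in del_V) && (dst e \in del_V)}.
Proof. by move=> e; rewrite !inE => /and3P[_ -> ->]. Qed.

Definition del : subgraph := Subgraph del_subproof.

End Deletion.

Definition boundary (A : {set vertex G}) : {set edge G} :=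
  [set e | (src e \in A) != (dst e \in A)].

Definition edge_cut_separating (C : {set edge G}) c x : Prop :=
  exists A : {set vertex G}, [/\ C = boundary A, c \in A & x \notin A].

End Graph.

Record strong_immersion (F G : mgraph)
    (thV : vertex F -> vertex G) (thE : edge F -> subgraph G) : Prop :=
  StrongImmersion {
    imm_inj : injective thV;
    imm_connected : forall e, sub_connected (thE e);
    imm_disjoint :
      forall e f, e != f -> [disjoint sub_E (thE e) & sub_E (thE f)];
    imm_incident : forall e v, incident e v -> thV v \in sub_V (thE e);
    imm_loop : forall e v,
      incident e v -> is_loop e -> has_cycle_through (thE e) (thV v);
    imm_strong : forall e v, ~~ incident e v -> thV v \notin sub_V (thE e) }.

Definition appears_as_strong_immersion (F G : mgraph) : Prop :=
  exists (thV : vertex F -> vertex G) (thE : edge F -> subgraph G),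
    strong_immersion thV thE.

Definition d (k : nat) : nat := (2 * k + 1) ^ (8 * k + 4) * k ^ 2 * (k + 1).

(* Main.v *)
(* Take a largest [Z] in [X] linked to [c] by edge-disjoint walks
   with no interior vertex in [X].  If [Z] is small, the largest tight cut
   yields [Y] and [K].  Otherwise keep the edges [Q] of these walks and pass to a
   minimal [H] containing [Q] in which every cut around a vertex of [Z] still has
   at least [k] edges; then at least half of the vertices of [Z] lie in a cut with
   exactly [k] edges.  Among them, since a vertex has at most [4 ^ p] important
   cuts of size at most [p], a sparse random subset [B] satisfies the cut
   condition for sending [k] edge-disjoint walks from each vertex of [B] to [c].
   The [k] walks of [b] use up all the edges of its cut of size [k], so no walk of
   another vertex passes through [b]: gluing walks at [c] gives a strong immersion
   of every [F] of maximum degree at most [k] with at most [#|B|] vertices. *)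
From mathcomp Require Import all_boot zify.
Require Import Defs.

Set Implicit Arguments.
Unset Strict Implicit.
Unset Printing Implicit Defensive.

(** * Menger's theorem for digraphs with several sources *)

Lemma card_set_sum (T : finType) (P : pred T) : #|[set x | P x]| = \sum_x P x.
Proof. by rewrite -sum1dep_card big_mkcond /=; apply: eq_bigr => x _; case: (P x). Qed.

Lemma sum_card_fibers (A V : finType) (P : pred A) (g : A -> V) (S : {set V}) :
  \sum_(v in S) #|[set a | P a && (g a == v)]| = #|[set a | P a && (g a \in S)]|.
Proof.
rewrite -[RHS]sum1dep_card (partition_big g (mem S)) /=; last by move=> a /andP[].
apply: eq_bigr => v vS; rewrite -sum1dep_card; apply: eq_bigl => a.
by case: eqP => [->|]; rewrite ?andbT ?andbF // vS andbT.
Qed.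

Section Digraph.
Variables (V A : finType) (tl hd : A -> V) (c : V).
Implicit Types (D : {set A}) (S T : {set V}).

Definition out_arcs D S : {set A} := [set a in D | (tl a \in S) && (hd a \notin S)].

(** Arc-disjoint walks are encoded by a partial labelling of the arcs: walk [i] uses the arcs
    labelled [Some i], and an arc has at most one label. *)
Definition arc_rel (I : eqType) (f : A -> option I) i : rel V :=
  fun u v => [exists a, [&& f a == Some i, tl a == u & hd a == v]].

Definition sources (I : finType) (s : I -> V) S : {set I} := [set i | s i \in S].

Definition balanced (I : finType) (f : pred A) (s : I -> V) :=
  forall v, v != c -> #|[set a | f a && (tl a == v)]|
    = #|[set a | f a && (hd a == v)]| + #|[set i | s i == v]|.

Lemma card_sources (I : finType) (s : I -> V) S :
  #|sources s S| = \sum_i (s i \in S).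
Proof. exact: card_set_sum. Qed.

Lemma card_out_arcs D S :
  #|out_arcs D S| = \sum_(a in D) ((tl a \in S) && (hd a \notin S)).
Proof.
rewrite -sum1dep_card big_mkcondr /=.
by apply: eq_bigr => a _; case: ifP.
Qed.

Lemma sources_modular (I : finType) (s : I -> V) S T :
  #|sources s (S :|: T)| + #|sources s (S :&: T)| = #|sources s S| + #|sources s T|.
Proof.
rewrite !card_sources -!big_split; apply: eq_bigr => i _ /=.
by rewrite !inE; case: (_ \in S); case: (_ \in T).
Qed.

Lemma out_arcs_submodular D S T :
  #|out_arcs D (S :|: T)| + #|out_arcs D (S :&: T)| <= #|out_arcs D S| + #|out_arcs D T|.
Proof.
rewrite !card_out_arcs -!big_split; apply: leq_sum => a _ /=.
by rewrite !inE; do 4!case: (_ \in _).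
Qed.

Definition feasible (I : finType) (s : I -> V) D :=
  forall S, c \notin S -> #|sources s S| <= #|out_arcs D S|.

Definition tight (I : finType) (s : I -> V) D S :=
  (c \notin S) && (#|sources s S| == #|out_arcs D S|).

(** Uncrossing: sources are counted modularly and leaving arcs submodularly, so zero slack at [S]
    and [T] forces zero slack at the union, the slack at the intersection being nonnegative. *)
Lemma tightU (I : finType) (s : I -> V) D S T : feasible s D ->
  tight s D S -> tight s D T -> tight s D (S :|: T).
Proof.
move=> fe /andP[cS /eqP eS] /andP[cT /eqP eT].
have cU : c \notin S :|: T by rewrite inE negb_or cS.
have cI : c \notin S :&: T by rewrite inE negb_and cS.
rewrite /tight cU; have := fe _ cU; have := fe _ cI.
by have := sources_modular s S T; have := out_arcs_submodular D S T; lia.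
Qed.

Lemma tight0 (I : finType) (s : I -> V) D : tight s D set0.
Proof.
rewrite /tight inE card_sources card_out_arcs !big1 // => i _; by rewrite !inE.
Qed.

(** Tight sets are closed under union, so one of maximum cardinality absorbs all others; [p] allows
    a restriction such as avoiding a given vertex. *)
Lemma max_tight (I : finType) (s : I -> V) D (p : pred {set V}) : feasible s D ->
    p set0 -> (forall S T, p S -> p T -> p (S :|: T)) ->
  exists U, [/\ tight s D U, p U & forall S, tight s D S -> p S -> S \subset U].
Proof.
move=> fe p0 pU; pose P S := tight s D S && p S.
have P0 : P set0 by rewrite /P tight0.
case: (arg_maxnP (fun S : {set V} => #|S|) P0) => U /andP[tU pU'] maxU.
exists U; split=> // S tS pS; have := maxU (S :|: U).
rewrite /P tightU // pU // => /(_ isT) le.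
have /eqP -> : U == S :|: U by rewrite eqEcard subsetUr.
exact: subsetUl.
Qed.

(* A source moves along an arc whose head lies in no tight set avoiding its
   tail; such an arc exists because otherwise the largest tight set avoiding the
   source, enlarged by the source, would violate the cut condition. *)
Lemma feasible_step (I : finType) (s : I -> V) D i :
  feasible s D -> s i != c ->
  exists2 a, a \in D /\ tl a = s i &
    feasible (fun j => if j == i then hd a else s j) (D :\ a).
Proof.
move=> fe ic.
have [|S T|U [tU iU maxU]] := @max_tight I s D (fun S => s i \notin S) fe.
- by rewrite inE.
- by rewrite inE negb_or => -> ->.
have /andP[cU /eqP eU] := tU.
have [/existsP[a /and3P[aD /eqP ta hU]] | /existsPn none] :=
  boolP [exists a, [&& a \in D, tl a == s i & hd a \notin U]]; last first.
  have cU' : c \notin s i |: U by rewrite !inE negb_or eq_sym ic.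
  have outU : out_arcs D (s i |: U) \subset out_arcs D U.
    apply/subsetP => a; rewrite !inE negb_or => /and3P[aD /orP[ta | ->] /andP[_ hU]].
      by have := none a; rewrite aD ta hU.
    by rewrite aD hU.
  have srcU : sources s U \proper sources s (s i |: U).
    apply/properP; split; first by apply/subsetP => j; rewrite !inE => ->; rewrite orbT.
    by exists i; rewrite !inE ?eqxx.
  by have := fe _ cU'; have := subset_leq_card outU; have := proper_card srcU; lia.
exists a => // S cS.
have srcE : #|sources (fun j => if j == i then hd a else s j) S| + (s i \in S)
    = #|sources s S| + (hd a \in S).
  rewrite !card_sources (bigD1 i) //= eqxx [in RHS](bigD1 i) //=.
  rewrite (eq_bigr (fun j => s j \in S : nat)); first by lia.
  by move=> j /negPf ->.
have outE : #|out_arcs (D :\ a) S| + ((s i \in S) && (hd a \notin S)) = #|out_arcs D S|.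
  rewrite !card_out_arcs [RHS](bigD1 a) //= ta addnC; congr (_ + _).
  by apply: eq_bigl => b; rewrite !inE andbC.
have := fe _ cS.
(* Only a set holding the head of [a] but not its tail gains a source while keeping its leaving
   arcs; if it were tight it would lie in [U], which misses the head. *)
have : (s i \notin S) && (hd a \in S) -> #|sources s S| != #|out_arcs D S|.
  move=> /andP[iS hS]; apply: contra hU => eqS.
  by apply: (subsetP (maxU S _ iS)); rewrite // /tight cS.
by case: (s i \in S) srcE outE; case: (hd a \in S) => /=; lia.
Qed.

(** Induction on the number of arcs: when a source moves along an arc, that arc is deleted and
    receives the label of the source, so it cannot be reused. *)
Lemma menger (I : finType) (s : I -> V) D : feasible s D ->
  exists f : A -> option I, [/\ forall a, f a -> a \in D,
    forall i, connect (arc_rel f i) (s i) c & balanced (fun a => f a : bool) s].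
Proof.
have [n] := ubnP #|D|; elim: n D s => // n IHn D s ltDn fe.
have [/existsP[i ic] | /existsPn none] := boolP [exists i, s i != c]; last first.
  exists (fun=> None); split=> // [i | v vc].
    by have := none i; rewrite negbK => /eqP ->; apply: connect0.
  rewrite !eq_card0 // => i; rewrite !inE //=.
  by have := none i; rewrite negbK => /eqP ->; rewrite eq_sym (negPf vc).
have [a [aD ta] fe'] := feasible_step fe ic.
have [|f' [f'D f'c f'b]] := IHn _ _ _ fe'.
  by rewrite (cardsD1 a) aD in ltDn; lia.
pose f b := if b == a then Some i else f' b.
have f'a : f' a = None.
  by case E: (f' a) => [j|] //; have := f'D a; rewrite E !inE eqxx => /(_ isT).
have subf j : subrel (arc_rel f' j) (arc_rel f j).
  move=> u v /existsP[b /and3P[fb tb hb]]; apply/existsP; exists b.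
  rewrite tb hb /f; case: (b =P a) => [ba|]; last by rewrite fb.
  by rewrite ba f'a in fb.
exists f; split=> [b | j | v vc].
- by rewrite /f; case: eqP => [->|_ /f'D] //; rewrite inE => /andP[].
- have := f'c j; case: (j =P i) => [-> | ji] cj; last first.
    by apply: connect_sub cj => u v /subf; apply: connect1.
  apply: (@connect_trans _ _ (hd a)).
    by apply: connect1; apply/existsP; exists a; rewrite /f ta !eqxx.
  by apply: connect_sub cj => u v /subf; apply: connect1.
have fcard (g : A -> V) : #|[set b | f b && (g b == v)]|
    = #|[set b | f' b && (g b == v)]| + (g a == v).
  rewrite !card_set_sum (bigD1 a) //= [in RHS](bigD1 a) //=.
  rewrite /f eqxx f'a /= add0n addnC; congr (_ + _).
  by apply: eq_bigr => b /negPf ->.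
have scard : #|[set j | (if j == i then hd a else s j) == v]| + (s i == v)
    = #|[set j | s j == v]| + (hd a == v).
  rewrite !card_set_sum (bigD1 i) //= eqxx [in RHS](bigD1 i) //=.
  by rewrite (eq_bigr (fun j => s j == v : nat)) => [|j /negPf -> //]; lia.
by have := f'b v vc; rewrite !fcard ta; lia.
Qed.

(** Summing conservation over [S], the arcs inside [S] cancel. *)
Lemma balanced_out (I : finType) (f : pred A) (s : I -> V) S :
    balanced f s -> c \notin S ->
  #|[set a | f a && ((tl a \in S) && (hd a \notin S))]|
  = #|[set a | f a && ((hd a \in S) && (tl a \notin S))]| + #|sources s S|.
Proof.
move=> bal cS.
have : \sum_(v in S) #|[set a | f a && (tl a == v)]|
    = \sum_(v in S) #|[set a | f a && (hd a == v)]| + #|sources s S|.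
  rewrite /sources -(sum_card_fibers xpredT s) -big_split /=.
  by apply: eq_bigr => v vS; apply: bal; apply: contraNneq cS => <-.
rewrite !sum_card_fibers.
rewrite -(cardsID [set a | hd a \in S] [set a | f a && (tl a \in S)]).
rewrite -(cardsID [set a | tl a \in S] [set a | f a && (hd a \in S)]).
set A1 := _ :&: _; set A2 := _ :\: _; set B1 := _ :&: _; set B2 := _ :\: _.
have -> : A1 = B1 by apply/setP => a; rewrite !inE; lia.
have -> : [set a | f a && ((tl a \in S) && (hd a \notin S))] = A2.
  by apply/setP => a; rewrite !inE; lia.
have -> : [set a | f a && ((hd a \in S) && (tl a \notin S))] = B2.
  by apply/setP => a; rewrite !inE; lia.
by lia.
Qed.
End Digraph.

(** * Edge cuts and edge-disjoint walks *)

Section Cuts.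
Variables (G : mgraph) (c : vertex G).
Implicit Types (H Q : {set edge G}) (S T : {set vertex G}) (e : edge G).

Definition cut H S : {set edge G} := boundary S :&: H.

Definition edge_rel H : rel (vertex G) := [rel u v | [exists e in H, joins e u v]].

(** Each edge becomes two opposite arcs, the boolean giving the direction; in the pattern [F] these
    arcs also serve as half-edges. *)
Definition arc_tail (a : edge G * bool) := if a.2 then src a.1 else dst a.1.
Definition arc_head (a : edge G * bool) := if a.2 then dst a.1 else src a.1.
Definition rev_arc (a : edge G * bool) := (a.1, ~~ a.2).

Lemma rev_arcK : involutive rev_arc.
Proof. by case=> e b; rewrite /rev_arc /= negbK. Qed.

Lemma arc_tail_rev a : arc_tail (rev_arc a) = arc_head a.
Proof. by case: a => e []. Qed.

Lemma arc_head_rev a : arc_head (rev_arc a) = arc_tail a.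
Proof. by case: a => e []. Qed.

Lemma card_cut H S : #|cut H S| = \sum_(e in H) ((src e \in S) != (dst e \in S)).
Proof.
rewrite (_ : cut H S = [set e in H | (src e \in S) != (dst e \in S)]).
  by rewrite -sum1dep_card big_mkcondr; apply: eq_bigr => e _ /=; case: (_ != _).
by apply/setP => e; rewrite !inE andbC.
Qed.

Lemma cut_submodular H S T :
  #|cut H (S :|: T)| + #|cut H (S :&: T)| <= #|cut H S| + #|cut H T|.
Proof.
rewrite !card_cut -!big_split; apply: leq_sum => e _ /=.
by rewrite !inE; do 4!case: (_ \in _).
Qed.

Lemma edge_rel_sym H : connect_sym (edge_rel H).
Proof.
apply: sym_connect_sym => u v /=; apply: eq_existsb => e.
by rewrite /joins orbC.
Qed.

Lemma sub_edge_rel H Q : H \subset Q ->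
  forall u v, connect (edge_rel H) u v -> connect (edge_rel Q) u v.
Proof.
move=> HQ; apply: connect_sub => u v /existsP[e /andP[eH je]].
by apply/connect1/existsP; exists e; rewrite (subsetP HQ).
Qed.

Lemma out_arcs_inj (D : {set edge G * bool}) S :
  {in out_arcs arc_tail arc_head D S &, injective fst}.
Proof.
move=> [e b] [e' b']; rewrite !inE /= => /and3P[_ te he] /and3P[_ te' he'] ee'.
move: te he te' he'; rewrite -ee'.
by rewrite /arc_tail /arc_head /=; case: b; case: b' => // /= ->.
Qed.

Lemma out_arcs_boundary (D : {set edge G * bool}) S a :
  a \in out_arcs arc_tail arc_head D S -> a.1 \in boundary S.
Proof.
by case: a => e []; rewrite !inE /arc_tail /arc_head /= => /and3P[_]; do 2!case: (_ \in _).
Qed.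

Lemma card_out_arcs_le_cut (D : {set edge G * bool}) H S :
  (forall a, a \in D -> a.1 \in H) -> #|out_arcs arc_tail arc_head D S| <= #|cut H S|.
Proof.
move=> DH; rewrite -(card_in_imset (@out_arcs_inj D S)).
apply/subset_leq_card/subsetP => _ /imsetP[a aD ->].
by rewrite inE (out_arcs_boundary aD) DH //; move: aD; rewrite inE => /andP[].
Qed.

Lemma card_cut_le_out_arcs (D : {set edge G * bool}) H S :
  (forall a, a.1 \in H -> a \in D) -> #|cut H S| <= #|out_arcs arc_tail arc_head D S|.
Proof.
move=> HD; apply: leq_trans (leq_imset_card fst _).
apply/subset_leq_card/subsetP => e; rewrite !inE => /andP[eS eH].
case es: (src e \in S); rewrite es in eS; last first.
  apply/imsetP; exists (e, false); rewrite // !inE /arc_tail /arc_head /= es HD //.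
  by case: (dst e \in S) eS.
by apply/imsetP; exists (e, true); rewrite // !inE /arc_tail /arc_head /= es HD.
Qed.

(* Cancelling the edges used in both directions keeps the flow balanced, so a
   second application of Menger's theorem to the remaining arcs yields walks
   that are edge-disjoint and not only arc-disjoint. *)
Lemma edge_menger (I : finType) (s : I -> vertex G) H :
    (forall S, c \notin S -> #|sources s S| <= #|cut H S|) ->
  exists f : edge G -> option I, (forall e, f e -> e \in H) /\
    forall i, connect (edge_rel [set e | f e == Some i]) (s i) c.
Proof.
move=> feH; pose D : {set edge G * bool} := [set a | a.1 \in H].
have feD : feasible arc_tail arc_head c s D.
  move=> S cS; apply: leq_trans (feH S cS) _.
  by apply: card_cut_le_out_arcs => a; rewrite inE.
have [f1 [f1D _ bal]] := menger feD.
pose D2 := [set a | f1 a && ~~ f1 (rev_arc a)].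
have feD2 : feasible arc_tail arc_head c s D2.
  move=> S cS; have := balanced_out bal cS.
  set P := [set a | _]; set Q := [set a | _].
  rewrite -(cardsID [set a | f1 (rev_arc a)] P) -(cardsID [set a | f1 (rev_arc a)] Q).
  have -> : P :\: [set a | f1 (rev_arc a)] = out_arcs arc_tail arc_head D2 S.
    by apply/setP => a; rewrite !inE andbC -!andbA; do !bool_congr.
  (* Reversal is a bijection between the cancelled arcs leaving [S] and those entering it. *)
  suff -> : #|P :&: [set a | f1 (rev_arc a)]| = #|Q :&: [set a | f1 (rev_arc a)]|.
    by move=> ?; lia.
  rewrite -(card_imset _ (inv_inj rev_arcK)); apply: eq_card => a.
  rewrite -[a]rev_arcK mem_imset; last exact: (inv_inj rev_arcK).
  by rewrite !inE !rev_arcK arc_head_rev arc_tail_rev; do 2!case: (isSome _); rewrite ?andbT ?andbF.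
have [f2 [f2D f2c _]] := menger feD2.
have f2H a : f2 a -> a.1 \in H.
  by move=> /f2D; rewrite inE => /andP[/f1D]; rewrite inE.
(* At most one direction of an edge survives in [D2], so preferring [(e, true)] discards no
   label. *)
exists (fun e => if f2 (e, true) is Some i then Some i else f2 (e, false)).
split=> [e | i].
  by case E: (f2 (e, true)) => [i|] /=; [move=> _; apply: (f2H (e, true)); rewrite E | apply: f2H].
apply: connect_sub (f2c i) => u v /existsP[[e b] /and3P[/eqP fe /eqP tu /eqP hv]].
apply/connect1/existsP; exists e; rewrite !inE.
rewrite /joins -tu -hv /arc_tail /arc_head; case: b fe {tu hv} => /= fe; first by rewrite fe !eqxx.
case E: (f2 (e, true)) => [j|]; last by rewrite fe !eqxx orbT.
have := f2D (e, true); rewrite E inE => /(_ isT)/andP[f1e _].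
by have := f2D (e, false); rewrite fe inE /rev_arc /= f1e andbF => /(_ isT).
Qed.
End Cuts.

(** * Cycles from two edge-disjoint paths *)

Section Cycles.
Variable G : mgraph.
Implicit Types (H P Q : {set edge G}) (S : {set vertex G}) (u v b c : vertex G).

Lemma connect_crossing P S u v :
  connect (edge_rel P) u v -> u \notin S -> v \in S -> exists2 e, e \in P & e \in boundary S.
Proof.
move=> /connectP[p]; elim: p u => [|w p IHp] u /=.
  by move=> _ -> /negPf ->.
move=> /andP[/existsP[e /andP[eP je]] wp] vE uS vS.
have [wS | wS] := boolP (w \in S); last exact: IHp wp vE wS vS.
exists e => //; rewrite inE; case/orP: je => /andP[/eqP -> /eqP ->];
  by rewrite wS (negPf uS).
Qed.

(** The last clause has the shape into which [cycle] unfolds once an edge reaching [u] is put in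
    front; edges are distinct because no vertex is repeated. *)
Lemma simple_path_edges H u p : path (edge_rel H) u p -> uniq (u :: p) ->
  exists s : seq (vertex G * edge G),
  [/\ [seq x.1 | x <- s] = belast u p, uniq [seq x.2 | x <- s],
      {in s, forall x, [/\ x.2 \in H, src x.2 \in u :: p & dst x.2 \in u :: p]}
    & forall y z, joins y.2 y.1 u -> z.1 = last u p ->
        path [rel x x' | joins x.2 x.1 x'.1] y (rcons s z)].
Proof.
elim: p u => [|v p IHp] u; first by exists [::]; split=> //= y z yu ->; rewrite yu.
move=> /andP[/existsP[e /andP[eH je]] vp] /andP[uvp un].
have [s [s1 s2 sH sp]] := IHp _ vp un.
exists ((u, e) :: s); split=> /=.
- by rewrite s1.
- rewrite s2 andbT; apply/mapP => -[x xs ex]; have [_ srcx dstx] := sH x xs.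
  rewrite /= in ex; rewrite -ex in srcx dstx.
  by case/orP: je => /andP[/eqP eq1 /eqP eq2]; case/negP: uvp; rewrite -?[u]eq1 -?[u]eq2.
- move=> x; rewrite inE => /predU1P[-> | /sH[-> xs xd]]; last first.
    by rewrite !(in_cons u) xs xd !orbT.
  by case/orP: je => /andP[/eqP /= -> /eqP ->]; rewrite !inE !eqxx !orbT.
- by move=> y z yu zl /=; rewrite yu sp.
Qed.

(** Without the first edge [e] of a simple [Q]-path from [b], its other end still reaches [c] along
    [Q] and then [b] along [P]; a simple path back to [b] avoiding [e] closes up with [e]. *)
Lemma cycle_of_disjoint_paths P Q b c : b != c -> [disjoint P & Q] ->
    connect (edge_rel P) b c -> connect (edge_rel Q) b c ->
  exists s : seq (vertex G * edge G),
  [/\ is_cycle s, b \in [seq x.1 | x <- s]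
    & {in s, forall x, [/\ x.2 \in P :|: Q, connect (edge_rel (P :|: Q)) b x.1
        & connect (edge_rel (P :|: Q)) b (src x.2)]}].
Proof.
move=> bc dPQ Pbc /connectP[q0 q0P cE].
move: cE bc Pbc; case: (shortenP q0P) => q qP qun _ -> {c q0 q0P}.
case: q qP qun => [|u q] /=; first by rewrite eqxx.
move=> /andP[/existsP[e /andP[eQ je]] uq] /andP[bq qun] _ Pbc.
pose K := (P :|: Q) :\ e.
have eP : e \notin P.
  by apply/negP => eP; have /setP/(_ e) := disjoint_setI0 dPQ; rewrite !inE eP eQ.
have eb : incident e b by case/orP: je => /andP[h1 h2]; rewrite /incident ?h1 ?h2 ?orbT.
have Kuc : connect (edge_rel K) u (last u q).
  apply/connectP; exists q => //; elim: q u uq bq {qun Pbc je} => //= v q IHq u.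
  move=> /andP[/existsP[g /andP[gQ jg]] vq] bu; rewrite IHq ?andbT //; last first.
    by apply: contra bu; rewrite !in_cons => ->; rewrite orbT.
  apply/existsP; exists g; rewrite jg andbT !inE gQ orbT andbT.
  apply: contraNneq bu => ge; move: eb; rewrite -ge /incident !inE.
  by case/orP: jg => /andP[/eqP -> /eqP ->] /orP[] /eqP <-; rewrite eqxx ?orbT.
have KPQ : K \subset P :|: Q by apply: subD1set.
have PK : P \subset K.
  by apply/subsetP => g gP; rewrite !inE gP /=; case: eqP gP => [-> /(negP eP)|].
have := sub_edge_rel PK Pbc; rewrite edge_rel_sym => Kcb.
have /connectP[p0 p0P bE] := connect_trans Kuc Kcb.
move: bE; case: (shortenP p0P) => p pP pun _ {p0 p0P} bE.
have [s [s1 s2 sK sp]] := simple_path_edges pP pun.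
have eun : e \in P :|: Q by rewrite inE eQ orbT.
have PQbu : connect (edge_rel (P :|: Q)) b u by apply/connect1/existsP; exists e; rewrite eun.
exists ((b, e) :: s); split; last first.
- have in_p w : w \in u :: p -> connect (edge_rel (P :|: Q)) b w.
    move=> wp; apply: connect_trans PQbu _; apply: (sub_edge_rel KPQ).
    exact: (path_connect pP).
  move=> x; rewrite inE => /predU1P[-> | xs] /=.
    by rewrite eun; split=> //; case/orP: je => /andP[/eqP -> _].
  have [xK srcx _] := sK x xs; split; [exact: (subsetP KPQ) | | exact: in_p].
  by apply: in_p; apply: mem_belast; rewrite -s1 map_f.
- by rewrite inE eqxx.
apply/and4P; split=> //.
- by rewrite /= s1 bE -rcons_uniq -lastI.
- rewrite /= s2 andbT; apply/mapP => -[x xs /= ex].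
  by have [+ _ _] := sK x xs; rewrite -ex !inE eqxx.
- exact: sp.
Qed.
End Cycles.

(** * Immersions from systems of walks *)

Section ComponentSubgraph.
Variables (G : mgraph) (P : {set edge G}) (c : vertex G).

Definition comp_V : {set vertex G} := [set v | connect (edge_rel P) c v].

Definition comp_E : {set edge G} := [set e in P | (src e \in comp_V) && (dst e \in comp_V)].

Fact comp_closed : {in comp_E, forall e, (src e \in comp_V) && (dst e \in comp_V)}.
Proof. by move=> e; rewrite inE => /andP[]. Qed.

(** A set of labelled edges is only known to link sources to [c]; keeping the component of [c] makes
    the image of an edge connected. *)
Definition component_subgraph : subgraph G := Subgraph comp_closed.

Lemma comp_edge u v e : e \in P -> joins e u v -> u \in comp_V -> v \in comp_V.
Proof.
move=> eP je; rewrite !inE => /connect_trans; apply.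
by apply/connect1/existsP; exists e; rewrite eP.
Qed.

Lemma joinsC (e : edge G) u v : joins e u v = joins e v u.
Proof. by rewrite /joins orbC. Qed.

Lemma joins_ends (e : edge G) : joins e (src e) (dst e).
Proof. by rewrite /joins !eqxx. Qed.

Lemma comp_EP e : (e \in comp_E) = (e \in P) && (src e \in comp_V).
Proof.
rewrite inE; case eP: (e \in P) => //=.
case es: (src e \in comp_V) => //=.
exact: comp_edge eP (joins_ends e) es.
Qed.

Lemma comp_connected : sub_connected component_subgraph.
Proof.
have symm : connect_sym (sub_adj component_subgraph).
  by apply: sym_connect_sym => u v /=; apply: eq_existsb => e; rewrite joinsC.
have from_c v : v \in comp_V -> connect (sub_adj component_subgraph) c v.
  rewrite inE => /connectP[p]; elim/last_ind: p v => [|p w IHp] v; first by move=> _ ->.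
  rewrite rcons_path last_rcons => /andP[pP /existsP[e /andP[eP je]]] ->.
  have pc : last c p \in comp_V by rewrite inE; apply/connectP; exists p.
  apply: connect_trans (IHp _ pP erefl) (connect1 _).
  apply/existsP; exists e; rewrite je andbT inE eP /=.
  have wc := comp_edge eP je pc.
  by case/orP: je => /andP[/eqP -> /eqP ->]; rewrite wc pc.
split; first by apply/set0Pn; exists c; rewrite inE connect0.
move=> u v /from_c cu /from_c; apply: connect_trans; by rewrite symm.
Qed.
End ComponentSubgraph.

Section HalfEdges.
Variables (F : mgraph).

Lemma degree_tail (v : vertex F) : degree v = #|[set h | arc_tail h == v]|.
Proof.
rewrite -sum1dep_card (eq_bigl (fun h => arc_tail (h.1, h.2) == v)) => [|[]] //.
rewrite -(pair_big_dep xpredT (fun e b => arc_tail (e, b) == v) (fun _ _ => 1)) /=.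
rewrite /degree -!sum1dep_card big_mkcond [X in _ + X]big_mkcond -big_split /=.
by apply: eq_bigr => e _; rewrite big_mkcond big_bool.
Qed.

(** Numbers the half-edges sharing a vertex, so that each of them can be given its own walk from
    that vertex. *)
Definition slot (h : edge F * bool) := index h (enum [set h' | arc_tail h' == arc_tail h]).

Lemma slot_lt h : slot h < degree (arc_tail h).
Proof. by rewrite degree_tail cardE index_mem mem_enum inE. Qed.

Lemma slot_inj h h' : arc_tail h = arc_tail h' -> slot h = slot h' -> h = h'.
Proof.
by rewrite /slot => eqt; rewrite eqt; apply: (index_inj h); rewrite mem_enum inE ?eqt.
Qed.
End HalfEdges.

(* Each cut [boundary D_v] of size at most [k] is exhausted by the [k] walks
   that start at [thV v], so no other walk can reach [thV v]. *)
Lemma strong_immersion_of_cuts (k : nat) (G F : mgraph) (c : vertex G)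
    (H : {set edge G}) (thV : vertex F -> vertex G) :
    injective thV -> (forall v, thV v != c) -> (forall v : vertex F, degree v <= k) ->
    (forall S : {set vertex G}, c \notin S -> k * #|[set v | thV v \in S]| <= #|cut H S|) ->
    (forall v, exists S : {set vertex G}, [/\ thV v \in S, c \notin S & #|cut H S| <= k]) ->
  appears_as_strong_immersion F G.
Proof.
move=> th_inj thc degk feH small.
pose s (i : vertex F * 'I_k) := thV i.1.
have fes (S : {set vertex G}) : c \notin S -> #|sources s S| <= #|cut H S|.
  move=> cS; apply: leq_trans (feH S cS); rewrite mulnC.
  rewrite (_ : sources s S = setX [set v | thV v \in S] setT).
    by rewrite cardsX cardsT card_ord.
  by apply/setP => i; rewrite !inE andbT.
have [f [fH fc]] := edge_menger fes.
have slotk (h : edge F * bool) : slot h < k by apply: leq_trans (slot_lt h) (degk _).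
pose lab h := (arc_tail h, Ordinal (slotk h)).
have lab_inj : injective lab.
  by move=> h h' [eqt eqs]; apply: slot_inj.
pose P h := [set g | f g == Some (lab h)].
(* The image of [e] glues, at [c], the walks assigned to its two half-edges. *)
pose W e := P (e, true) :|: P (e, false).
have PW h : P h \subset W h.1 by case: h => e []; [apply: subsetUl | apply: subsetUr].
have WP e g : g \in W e -> exists b, f g = Some (lab (e, b)).
  by rewrite !inE => /orP[] /eqP ->; [exists true | exists false].
have thW h : connect (edge_rel (W h.1)) c (thV (arc_tail h)).
  rewrite edge_rel_sym; apply: (sub_edge_rel (PW h)); exact: (fc (lab h)).
exists thV, (fun e => component_subgraph (W e) c); split=> //.
- by move=> e; apply: comp_connected.
- move=> e e' ee'; apply/pred0P => g /=; apply/negP => /andP[].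
  rewrite !comp_EP => /andP[/WP[b gb] _] /andP[/WP[b' gb'] _].
  by move: gb'; rewrite gb => -[eqt eqs]; have [/eqP] := slot_inj eqt eqs; rewrite (negPf ee').
- by move=> e v /orP[] /eqP <-; rewrite inE; [apply: (thW (e, true)) | apply: (thW (e, false))].
- move=> e v ev /eqP loop.
  have [v1 v0] : arc_tail (e, true) = v /\ arc_tail (e, false) = v.
    by rewrite /arc_tail /= -loop; case/orP: ev => /eqP <-.
  have dP : [disjoint P (e, true) & P (e, false)].
    apply/pred0P => g /=; rewrite !inE; apply/negP => /andP[/eqP -> /eqP[]] eqt eqs.
    by have := slot_inj eqt eqs.
  have := fc (lab (e, true)); have := fc (lab (e, false)).
  rewrite /s /= v1 v0 => c0 c1.
  have [l [lcyc vl lP]] := cycle_of_disjoint_paths (thc v) dP c1 c0.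
  exists l; split=> // x xl; have [xW cx csrc] := lP x xl.
  have cv : connect (edge_rel (W e)) c (thV v) by have := thW (e, true); rewrite v1.
  by rewrite /= comp_EP !inE in xW *; rewrite xW !(connect_trans cv).
- move=> e v nev; apply/negP; rewrite inE => cv.
  have [S [vS cS Sk]] := small v.
  have [g gW gS] := connect_crossing cv cS vS.
  (* Each of the [k] walks from [thV v] crosses this cut, which has at most [k] edges; hence every
     edge of the cut carries a label of [v]. *)
  have full : [set Some (v, i) | i in 'I_k] = [set f g | g in cut H S].
    apply/eqP; rewrite eqEcard; apply/andP; split; last first.
      apply: leq_trans (leq_imset_card _ _) (leq_trans Sk _).
      by rewrite card_imset ?card_ord // => i j [].
    apply/subsetP => _ /imsetP[i _ ->].
    have := fc (v, i); rewrite edge_rel_sym => /connect_crossing/(_ cS vS)[g'].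
    rewrite inE => /eqP fg' g'S; apply/imsetP; exists g' => //.
    by rewrite inE g'S fH // fg'.
  have [b fg] := WP _ _ gW.
  have : f g \in [set f g | g in cut H S].
    by apply: imset_f; rewrite inE gS fH // fg.
  rewrite -full => /imsetP[i _]; rewrite fg => -[tv _].
  by move: nev; rewrite /incident -tv /arc_tail; case: (b); rewrite eqxx ?orbT.
Qed.

(** * Linked subsets *)

Section Linked.
Variables (G : mgraph) (c : vertex G) (X : {set vertex G}).
Hypothesis cX : c \notin X.
Implicit Types (H Q : {set edge G}) (S T Z : {set vertex G}).

(** Vertices outside [Z] are parked at the sink, where they impose no condition; thus the index type
    does not depend on [Z]. *)
Definition source_at Z x : vertex G := if x \in Z then x else c.

Lemma sources_at Z S : c \notin S -> sources (source_at Z) S = Z :&: S.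
Proof.
move=> cS; apply/setP => x; rewrite !inE /source_at.
by case: (x \in Z) => //=; apply: negPf.
Qed.

(* Arcs into [X] are discarded, so that no walk passes through [X]. *)
Definition arcs_avoiding : {set edge G * bool} := [set a | arc_head a \notin X].

Lemma component_cut (k : nat) Z : 0 < k -> Z \subset X ->
    feasible (@arc_tail G) (@arc_head G) c (source_at Z) arcs_avoiding ->
    (forall x, x \in X -> x \notin Z ->
      ~ feasible (@arc_tail G) (@arc_head G) c (source_at (x |: Z)) arcs_avoiding) ->
  exists (Y : {set vertex G}) (K : {set edge G}),
    [/\ Y \subset X, k * #|Y| + #|K| <= k * #|Z| & [disjoint component (del Y K) c & X]].
Proof.
move=> k0 ZX fe maxZ.
have [//|//|T [/andP[cT /eqP eT] _ maxT]] :=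
  @max_tight _ _ (@arc_tail G) (@arc_head G) c _ _ _ predT fe.
(* If [x] is outside [T], no tight set contains it, and one more source at [x] would fit every
   cut. *)
have XT x : x \in X -> x \notin Z -> x \in T.
  move=> xX xZ; apply: contra_notT (maxZ x xX xZ) => xT S cS.
  have := fe _ cS; rewrite !sources_at // => le; rewrite setIUl.
  have xc : x != c by apply: contraNneq cX => <-.
  have [xS | xS] := boolP (x \in S); last first.
    rewrite (_ : [set x] :&: S = set0) ?set0U //; apply/setP => y.
    by rewrite !inE; case: eqP => // ->; apply: negPf.
  have /setIidPl -> : [set x] \subset S by rewrite sub1set.
  rewrite cardsU1 inE (negPf xZ) /= add1n ltn_neqAle le andbT.
  apply: contra xT => eqS; apply: (subsetP (maxT S _ isT)) => //.
  by rewrite /tight cS sources_at.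
pose K := [set a.1 | a in out_arcs (@arc_tail G) (@arc_head G) arcs_avoiding T].
exists (Z :\: T), K; split.
- exact: subset_trans (subsetDl _ _) ZX.
- have KZ : #|K| <= #|Z :&: T|.
    by rewrite -(sources_at Z cT) eT leq_imset_card.
  rewrite -(cardsID T Z) mulnDr addnC leq_add2r.
  by apply: leq_trans KZ _; rewrite leq_pmull.
- apply/pred0P => x /=; apply/negP => /andP[]; rewrite !inE => /and3P[xY cY cx] xX.
  have xT : x \in T.
    by have [xZ | xZ] := boolP (x \in Z); [move: xY; rewrite xZ andbT negbK | apply: XT].
  have [e eD eT'] : exists2 e : edge G, e \in sub_E (del (Z :\: T) K) & e \in boundary T.
    exact: connect_crossing cx cT xT.
  move: eD eT'; rewrite inE => /and3P[eK sY dY] eB.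
  (* An arc leaving [T] whose edge is not in [K] must end in [X], hence in [Y], because [X] minus
     [T] lies in [Z]. *)
  have aK a : a.1 = e -> arc_tail a \in T -> arc_head a \notin T ->
      arc_head a \notin Z :\: T -> False.
    move=> ae ta ha haY; case/negP: eK; apply/imsetP; exists a => //.
    rewrite !inE ta ha /= andbT; apply/negP => hX.
    by move: haY; rewrite inE ha /=; apply/negP; rewrite negbK; apply: contraNT ha; apply: XT.
  move: eB; rewrite inE; case sT: (src e \in T); case dT: (dst e \in T) => // _.
    by apply: (aK (e, true)); rewrite // /arc_tail /arc_head /= ?sT ?dT.
  by apply: (aK (e, false)); rewrite // /arc_tail /arc_head /= ?sT ?dT.
Qed.

(** No arc in use enters [X], so by conservation exactly one leaves each [x] in [Z]. *)
Lemma linking_edges Z : Z \subset X ->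
    feasible (@arc_tail G) (@arc_head G) c (source_at Z) arcs_avoiding ->
  exists Q, (forall S, c \notin S -> #|Z :&: S| <= #|cut Q S|) /\
    {in Z, forall x, #|cut Q [set x]| <= 1}.
Proof.
move=> ZX fe; have [f [fD _ bal]] := menger fe.
pose D := [set a | isSome (f a)].
exists [set a.1 | a in D]; split=> [S cS | x xZ].
  rewrite -(sources_at Z cS).
  apply: leq_trans (@card_out_arcs_le_cut _ D _ S _); last by move=> a aD; apply: imset_f.
  apply: (@leq_trans #|[set a | f a && ((arc_tail a \in S) && (arc_head a \notin S))]|).
    by rewrite (balanced_out bal cS) leq_addl.
  by apply/subset_leq_card/subsetP => a; rewrite !inE.
have xX := subsetP ZX x xZ.
have fX a : f a -> arc_head a != x.
  by move=> /fD; rewrite inE; apply: contraNneq => ->.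
have xc : x != c by apply: contraNneq cX => <-.
have := bal x xc.
rewrite [X in X + _]eq_card0; last first.
  by move=> a; rewrite !inE; apply/negP => /andP[/fX /negPf ->].
rewrite (_ : [set i | source_at Z i == x] = [set x]); last first.
  apply/setP => y; rewrite !inE /source_at; case yZ: (y \in Z) => //.
  by rewrite eq_sym (negPf xc); apply/esym; apply: contraFF yZ => /eqP ->.
rewrite cards1 add0n => <-; apply: leq_trans (leq_imset_card fst _).
apply/subset_leq_card/subsetP => e; rewrite !inE => /andP[eB /imsetP[a]].
rewrite inE => fa ea; apply/imsetP; exists a => //; rewrite inE fa /=.
have := fX a fa; move: eB; rewrite ea; case: (a) => g []; rewrite /arc_tail /arc_head /= => eB.
  by move=> /negPf dx; move: eB; rewrite dx; case: (src g == x).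
by move=> /negPf dx; move: eB; rewrite dx; case: (dst g == x).
Qed.

Lemma linked_subset (k : nat) : 0 < k -> exists2 Z : {set vertex G}, Z \subset X &
  (exists (Y : {set vertex G}) (K : {set edge G}),
    [/\ Y \subset X, k * #|Y| + #|K| <= k * #|Z| & [disjoint component (del Y K) c & X]])
  /\ exists Q, (forall S, c \notin S -> #|Z :&: S| <= #|cut Q S|) /\
    {in Z, forall x, #|cut Q [set x]| <= 1}.
Proof.
move=> k0.
pose fe Z := [forall (S : {set vertex G} | c \notin S),
  #|Z :&: S| <= #|out_arcs (@arc_tail G) (@arc_head G) arcs_avoiding S|].
have feP Z : reflect (feasible (@arc_tail G) (@arc_head G) c (source_at Z) arcs_avoiding) (fe Z).
  apply: (iffP forall_inP) => h S cS; have := h S cS; by rewrite sources_at.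
pose P Z := (Z \subset X) && fe Z.
have P0 : P set0 by rewrite /P sub0set; apply/forall_inP => S _; rewrite set0I cards0.
case: (arg_maxnP (fun Z : {set vertex G} => #|Z|) P0) => Z /andP[ZX /feP feZ] maxZ.
exists Z => //; split; last exact: linking_edges.
apply: component_cut => // x xX xZ /feP fex.
have := maxZ (x |: Z); rewrite /P fex subUset sub1set xX ZX => /(_ isT).
by rewrite cardsU1 xZ /= add1n ltnn.
Qed.
End Linked.

(** * Minimal subgraphs and tight cuts *)

Section MinimalSubgraph.
Variables (G : mgraph) (c : vertex G) (Z : {set vertex G}) (k : nat).
Hypothesis cZ : c \notin Z.
Implicit Types (H Q : {set edge G}) (S T : {set vertex G}) (x y : vertex G).

Definition cut_connected H :=
  forall S, c \notin S -> Z :&: S != set0 -> k <= #|cut H S|.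

Definition tight_cut H S := [&& c \notin S, Z :&: S != set0 & #|cut H S| == k].

Definition tight_vertices H : {set vertex G} :=
  [set x in Z | [exists S : {set vertex G}, tight_cut H S && (x \in S)]].

(** A common vertex of [Z] makes the intersection subject to the bound [k]; submodularity then pins
    the cut of the union to [k]. *)
Lemma tight_cutU H S T x : cut_connected H -> x \in Z -> x \in S -> x \in T ->
  tight_cut H S -> tight_cut H T -> tight_cut H (S :|: T).
Proof.
move=> conH xZ xS xT /and3P[cS _ /eqP eS] /and3P[cT _ /eqP eT].
have cU : c \notin S :|: T by rewrite inE negb_or cS.
have cI : c \notin S :&: T by rewrite inE negb_and cS.
have nU : Z :&: (S :|: T) != set0 by apply/set0Pn; exists x; rewrite !inE xZ xS.
have nI : Z :&: (S :&: T) != set0 by apply/set0Pn; exists x; rewrite !inE xZ xS xT.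
rewrite /tight_cut cU nU /=.
by have := conH _ cU nU; have := conH _ cI nI; have := cut_submodular H S T; lia.
Qed.

Lemma max_tight_cut H x : cut_connected H -> x \in tight_vertices H ->
  exists T, [/\ tight_cut H T, x \in T
    & forall S, tight_cut H S -> x \in S -> S \subset T].
Proof.
move=> conH; rewrite inE => /andP[xZ /existsP[S0 PS0]].
pose P S := tight_cut H S && (x \in S).
have {}PS0 : P S0 := PS0.
case: (arg_maxnP (fun S : {set vertex G} => #|S|) PS0) => T /andP[tT xT] maxT.
exists T; split=> // S tS xS; have := maxT (S :|: T).
rewrite /P inE xS orTb andbT (tight_cutU conH xZ) // => /(_ isT) le.
have /eqP -> : T == S :|: T by rewrite eqEcard subsetUr.
exact: subsetUl.
Qed.

(* In a minimal [H] every edge outside [Q] crosses a tight cut.  A vertex of [Z]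
   in no tight cut therefore sends all but one of its at least [k + 1] edges into
   the maximal tight cuts, and there are at most as many of these as tight
   vertices. *)
Lemma minimal_subgraph Q : 0 < k -> cut_connected setT ->
    {in Z, forall x, #|cut Q [set x]| <= 1} ->
  exists H, [/\ Q \subset H, cut_connected H & #|Z| <= 2 * #|tight_vertices H|].
Proof.
move=> k0 con1 Q1.
pose P H := (Q \subset H) &&
  [forall (S : {set vertex G} | (c \notin S) && (Z :&: S != set0)), k <= #|cut H S|].
have conP H : Q \subset H -> reflect (cut_connected H) (P H).
  rewrite /P => ->; apply: (iffP forall_inP) => h S; last by move=> /andP[]; apply: h.
  by move=> cS ZS; apply: h; rewrite cS.
have PT : P setT by apply/conP => //; apply: subsetT.
case: (arg_minnP (fun H : {set edge G} => #|H|) PT) => H PH minH.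
have QH : Q \subset H by case/andP: PH.
have conH : cut_connected H by apply/conP.
exists H; split=> //; set W := tight_vertices H.
have [T tT] : exists T : vertex G -> {set vertex G}, forall y, y \in W ->
    [/\ tight_cut H (T y), y \in T y & forall S, tight_cut H S -> y \in S -> S \subset T y].
  apply: (@fin_all_exists _ _ (fun y T => y \in W -> [/\ tight_cut H T, y \in T &
    forall S, tight_cut H S -> y \in S -> S \subset T])) => y.
  have [yW | _] := boolP (y \in W); last by exists set0.
  by have [T tT] := max_tight_cut conH yW; exists T.
have WZ : W \subset Z by apply/subsetP => y; rewrite inE => /andP[].
have hubT x S : x \in Z :\: W -> tight_cut H S -> x \notin S.
  rewrite inE => /andP[xW xZ] tS; apply: contra xW => xS.
  by rewrite inE xZ; apply/existsP; exists S; rewrite tS.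
(* By minimality, deleting [e] violates the bound at some set, whose cut in [H] therefore had
   exactly [k] edges, [e] among them. *)
have cross e : e \in H -> e \notin Q -> exists2 y, y \in W &
    exists S, [/\ tight_cut H S, y \in S & e \in boundary S].
  move=> eH eQ.
  have QHe : Q \subset H :\ e.
    by apply/subsetP => g gQ; rewrite !inE (subsetP QH _ gQ) andbT; apply: contraNneq eQ => <-.
  have : ~~ P (H :\ e).
    by apply/negP => /minH; rewrite (cardsD1 e H) eH add1n ltnn.
  rewrite /P QHe /= => /forall_inPn[S /andP[cS ZS]]; rewrite -ltnNge => lt.
  have cutD : cut (H :\ e) S = cut H S :\ e by apply/setP => g; rewrite !inE andbCA.
  rewrite cutD in lt; have := conH S cS ZS; rewrite (cardsD1 e (cut H S)) => ge.
  have eS : e \in cut H S by case: (e \in cut H S) ge => //; lia.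
  have tS : tight_cut H S.
    by rewrite /tight_cut cS ZS (cardsD1 e (cut H S)); rewrite eS in ge *; lia.
  have /set0Pn[y] := ZS; rewrite inE => /andP[yZ yS].
  exists y; first by rewrite inE yZ; apply/existsP; exists S; rewrite tS.
  by exists S; split=> //; move: eS; rewrite inE => /andP[].
pose N x := cut H [set x] :\: Q.
have N_out x e : x \in Z :\: W -> e \in N x -> exists y S,
    [/\ y \in W, tight_cut H S, y \in S, e \in boundary S & x \notin S].
  move=> xh; rewrite !inE => /andP[eQ /andP[_ eH]].
  have [y yW [S [tS yS eS]]] := cross e eH eQ.
  by exists y, S; split=> //; apply: hubT tS.
have Nk x : x \in Z :\: W -> k <= #|N x|.
  move=> xh; have := xh; rewrite inE => /andP[xW xZ].
  have xc : c \notin [set x] by rewrite inE; apply: contraNneq cZ => ->.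
  have nx : Z :&: [set x] != set0 by apply/set0Pn; exists x; rewrite !inE xZ eqxx.
  have := conH _ xc nx; have := Q1 x xZ.
  have : #|cut H [set x]| != k.
    have := contraTN (hubT x [set x] xh); rewrite inE eqxx => /(_ isT).
    by rewrite /tight_cut xc nx.
  have : #|cut H [set x] :&: Q| <= #|cut Q [set x]|.
    by apply/subset_leq_card/subsetP => e; rewrite !inE => /andP[/andP[-> _] ->].
  by rewrite -(cardsID Q (cut H [set x])) /N; lia.
(* An edge of [N x] crosses a tight set avoiding all of [Z :\: W], so its end inside that set cannot
   be [x']. *)
have N_disj x x' e : x \in Z :\: W -> x' \in Z :\: W -> e \in N x -> e \in N x' -> x = x'.
  move=> xh x'h ex ex'; have [y [S [yW tS yS eS xS]]] := N_out _ _ xh ex.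
  have x'S := hubT _ _ x'h tS.
  move: ex ex' eS; rewrite !inE => /and3P[_ xe _] /and3P[_ xe' _].
  have [sx | sx] := eqVneq (src e) x; have [sx' | sx'] := eqVneq (src e) x'.
  - by rewrite -sx -sx'.
  - have /eqP -> : dst e == x' by move: xe'; rewrite (negPf sx'); case: (dst e == x').
    by rewrite sx (negPf xS) (negPf x'S).
  - have /eqP -> : dst e == x by move: xe; rewrite (negPf sx); case: (dst e == x).
    by rewrite sx' (negPf xS) (negPf x'S).
  - have /eqP <- : dst e == x by move: xe; rewrite (negPf sx); case: (dst e == x).
    by have /eqP <- : dst e == x' by move: xe'; rewrite (negPf sx'); case: (dst e == x').
have card_sum (A : {set edge G}) : #|A| = \sum_e (e \in A) by rewrite -sum1_card big_mkcond.
(* Double counting: the tight set crossed by an edge of [N x] lies in some [T y], which still misses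
   [x], so the edge crosses [T y] as well. *)
have bound : \sum_(x in Z :\: W) #|N x| <= \sum_(y in W) #|cut H (T y)|.
  under eq_bigr do rewrite card_sum; under [X in _ <= X]eq_bigr do rewrite card_sum.
  rewrite exchange_big [X in _ <= X]exchange_big; apply: leq_sum => e _.
  have [/existsP[x /andP[xh ex]] | /existsPn none] :=
    boolP [exists x, (x \in Z :\: W) && (e \in N x)]; last first.
    by rewrite big1 // => x xh; have := none x; rewrite xh /= => /negPf ->.
  rewrite (bigD1 x) //= big1 ?addn0 => [|x' /andP[x'h x'x]]; last first.
    by apply/eqP; rewrite eqb0; apply: contra x'x => ex'; apply/eqP; apply: N_disj ex' ex.
  have [y [S [yW tS yS eS xS]]] := N_out _ _ xh ex.
  have [tTy yTy maxT] := tT y yW.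
  rewrite (bigD1 y) //= ex; apply: leq_trans (leq_addr _ _); rewrite lt0b.
  have xT := hubT _ _ xh tTy; have ST := subsetP (maxT S tS yS).
  move: ex eS; rewrite !inE => /and3P[_ xe eH]; rewrite eH andbT.
  have := ST (src e); have := ST (dst e).
  have [sx | sx] := eqVneq (src e) x.
    by rewrite sx (negPf xS) (negPf xT); case: (dst e \in S) => // ->.
  have /eqP -> : dst e == x by move: xe; rewrite (negPf sx); case: (dst e == x).
  by rewrite (negPf xS) (negPf xT); case: (src e \in S) => // _ ->.
have lo : k * #|Z :\: W| <= \sum_(x in Z :\: W) #|N x|.
  by rewrite mulnC -sum_nat_const; apply: leq_sum => x; apply: Nk.
have hi : \sum_(y in W) #|cut H (T y)| = k * #|W|.
  by rewrite mulnC -sum_nat_const; apply: eq_bigr => y /tT[/and3P[_ _ /eqP]].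
have := leq_trans lo bound; rewrite hi leq_pmul2l // => le.
by rewrite -(cardsID W Z) (setIidPr WZ) mul2n -addnn leq_add2l.
Qed.
End MinimalSubgraph.

(** * Important cuts *)

Section ImportantCuts.
Variables (G : mgraph) (c : vertex G).
Implicit Types (H : {set edge G}) (R S T : {set vertex G}).

Definition inner_edges H S T : {set edge G} :=
  [set e in H | [exists u in S, exists v in T, joins e u v]].

(** Reachability of all of [S] from [R] inside [S], expressed by the absence of a proper closed
    subset; this form combines directly with cuts. *)
Definition connected_from H R S :=
  [forall T : {set vertex G},
    [&& R \subset T, T \subset S & inner_edges H T (S :\: T) == set0] ==> (T == S)].

Lemma connected_fromP H R S : reflect
  (forall T, R \subset T -> T \subset S -> inner_edges H T (S :\: T) = set0 -> T = S)
  (connected_from H R S).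
Proof.
apply: (iffP forallP) => h T.
  by move=> RT TS E; have := h T; rewrite RT TS E eqxx => /eqP.
by apply/implyP => /and3P[RT TS /eqP E]; rewrite (h T).
Qed.

Lemma cutD1 H S e : e \in cut H S -> #|cut H S| = (#|cut (H :\ e) S|).+1.
Proof.
move=> eS; rewrite (cardsD1 e) eS; congr _.+1; apply: eq_card => g.
by rewrite !inE andbCA.
Qed.

Lemma cut_cardD1 H S e : #|cut H S| <= (#|cut (H :\ e) S|).+1.
Proof.
have [/cutD1 -> // | eS] := boolP (e \in cut H S); apply: leqW.
apply/subset_leq_card/subsetP => g gS; have := gS; rewrite !inE => /andP[-> ->].
by rewrite andbT; apply: contraNneq eS => <-.
Qed.

Lemma inner_edgesS H S T S' T' : S \subset S' -> T \subset T' ->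
  inner_edges H S T \subset inner_edges H S' T'.
Proof.
move=> SS TT; apply/subsetP => e; rewrite !inE => /andP[-> /=].
move=> /existsP[u /andP[uS /existsP[v /andP[vT juv]]]].
apply/existsP; exists u; rewrite (subsetP SS) //=; apply/existsP; exists v.
by rewrite (subsetP TT).
Qed.

(** A closed set containing [R'] meets [S] in a closed set containing [R], hence contains [S]. *)
Lemma connected_fromU H R R' S : R \subset S -> R \subset R' ->
  connected_from H R S -> connected_from H R' (S :|: R').
Proof.
move=> RS RR' /connected_fromP con; apply/connected_fromP => T R'T TS E.
suff TSS : T :&: S = S by apply/eqP; rewrite eqEsubset TS subUset R'T -TSS subsetIl.
apply: con; [by rewrite subsetI RS (subset_trans RR') | exact: subsetIr |].
apply/eqP; rewrite -subset0 -E; apply: inner_edgesS; first exact: subsetIl.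
by apply/subsetP => v; rewrite !inE => /andP[+ vS]; rewrite vS andbT => ->.
Qed.

Lemma connected_fromW H R R' S : R \subset R' ->
  connected_from H R S -> connected_from H R' S.
Proof.
move=> RR' /connected_fromP con; apply/connected_fromP => T R'T; apply: con.
exact: subset_trans R'T.
Qed.

Lemma connected_fromD1 H R S e : e \in boundary S ->
  connected_from H R S -> connected_from (H :\ e) R S.
Proof.
move=> eS /connected_fromP con; apply/connected_fromP => T RT TS E; apply: con => //.
apply/eqP; rewrite -subset0 -E; apply/subsetP => g; rewrite !inE => /andP[gH gT].
rewrite gH gT !andbT; apply: contraTneq gT => ->; apply/negP => /existsP[u /andP[uT]].
move=> /existsP[v /andP[]]; rewrite inE => /andP[_ vS] je; have uS := subsetP TS u uT.
move: eS; rewrite inE; case/orP: je => /andP[/eqP -> /eqP ->]; by rewrite uS vS eqxx.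
Qed.

(* Branch on an edge leaving the largest minimum cut around [R],
   which is either deleted (the budget [p] drops) or absorbed (the minimum cut
   grows); the potential [2 p - min cut] bounds the depth of the recursion. *)
Lemma important_cuts t p H R :
    (forall S, R \subset S -> c \notin S -> 2 * p <= t + #|cut H S|) ->
  exists L : seq {set vertex G}, size L <= 2 ^ t /\
    forall S, R \subset S -> c \notin S -> #|cut H S| <= p -> connected_from H R S ->
    exists2 T, T \in L & [/\ c \notin T, S \subset T & #|cut H T| <= #|cut H S|].
Proof.
elim/ltn_ind: t p H R => t IHt p H R pot.
pose P S := (R \subset S) && (c \notin S).
have [/existsP[S0 P0] | /existsPn none] := boolP [exists S, P S]; last first.
  by exists [::]; split=> // S RS cS; have := none S; rewrite /P RS cS.
case: (arg_minnP (fun S : {set vertex G} => #|cut H S|) P0) => S1 P1 min1.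
pose P' S := P S && (#|cut H S| == #|cut H S1|).
have P1' : P' S1 by rewrite /P' P1 eqxx.
case: (arg_maxnP (fun S : {set vertex G} => #|S|) P1') => M /andP[PM /eqP eM] maxM.
have {min1} minM S : R \subset S -> c \notin S -> #|cut H M| <= #|cut H S|.
  by move=> RS cS; rewrite eM min1 // /P RS.
have /andP[RM cM] := PM.
(* As [M] is a minimum cut, submodularity shows that absorbing [M] never enlarges a cut, so it
   suffices to cover [S :|: M]. *)
have push S : R \subset S -> c \notin S ->
    #|cut H (S :|: M)| <= #|cut H S| /\ c \notin S :|: M.
  move=> RS cS; split; last by rewrite inE negb_or cS.
  have := @minM (S :&: M); rewrite subsetI RS RM inE negb_and cS => /(_ isT isT).
  by have := cut_submodular H S M; clear; lia.
(* Otherwise [S :|: M] would be a larger minimum cut. *)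
have far S : R \subset S -> c \notin S -> ~~ (S \subset M) -> #|cut H M| < #|cut H S|.
  move=> RS cS; rewrite ltnNge; apply: contra => le.
  have [leU cU] := push S RS cS.
  have RU : R \subset S :|: M by apply: subset_trans RS (subsetUl _ _).
  have := maxM (S :|: M); rewrite /P' /P RU cU -eM eqn_leq minM // andbT.
  rewrite (leq_trans leU le) => /(_ isT) leM.
  have /eqP -> : M == S :|: M by rewrite eqEcard subsetUr.
  exact: subsetUl.
have [lt | ge] := ltnP p #|cut H M|.
  by exists [::]; split=> // S RS cS; have := minM S RS cS; move: lt; clear; lia.
have [cut0 | [e eM']] := set_0Vmem (cut H M).
  (* No edge of [H] leaves [M], so every [S] connected from [R] stays inside it. *)
  exists [:: M]; split; first by rewrite expn_gt0.
  move=> S RS cS _ /connected_fromP con; exists M; rewrite ?inE //; split=> //; last exact: minM.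
  rewrite -(con (S :&: M)) ?subsetIr ?subsetIl ?subsetI ?RS //.
  apply/eqP; rewrite -subset0 -cut0; apply/subsetP => g; rewrite !inE => /andP[->].
  move=> /existsP[u /andP[]]; rewrite inE => /andP[_ uM] /existsP[v /andP[]].
  rewrite !inE negb_and andb_orl andNb /= => /andP[/negPf vM _] jg; rewrite andbT.
  by case/orP: jg => /andP[/eqP -> /eqP ->]; rewrite uM vM.
have := eM'; rewrite inE => /andP[eB eH].
have cut_gt0 : 0 < #|cut H M| by rewrite card_gt0; apply/set0Pn; exists e.
have t_gt0 : 0 < t by have := pot M RM cM; move: ge cut_gt0; clear; lia.
pose v := if src e \in M then dst e else src e.
have vM : v \notin M.
  by move: eB; rewrite inE /v; case sM: (src e \in M); [case: (dst e \in M) | rewrite sM].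
(* Deletion of [e] lowers [2 * p] by two and a cut by at most one; absorption of [v] raises the
   minimum cut by [far]. Either way [t] can drop by one. *)
have [|S MS cS|L1 [szL1 L1P]] := IHt t.-1 _ p.-1 (H :\ e) M; first by rewrite prednK.
  have := minM S (subset_trans RM MS) cS; have := cut_cardD1 H S e.
  by have := pot M RM cM; move: ge cut_gt0 t_gt0; clear; lia.
have [|S vMS cS|L2 [szL2 L2P]] := IHt t.-1 _ p H (v |: M); first by rewrite prednK.
  have RS : R \subset S by apply: subset_trans RM (subset_trans (subsetUr _ _) vMS).
  have := far S RS cS; have := pot M RM cM.
  have -> : ~~ (S \subset M).
    by apply: contra vM => SM; apply: (subsetP SM); apply: (subsetP vMS); rewrite setU11.
  by move: t_gt0; clear; move=> ? ? /(_ isT); lia.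
exists (L1 ++ L2); split.
  by rewrite size_cat -(prednK t_gt0) expnS mul2n -addnn leq_add.
move=> S RS cS Sp con; have [leU cU] := push S RS cS.
have conU := connected_fromU RS RM con.
(* If [v] lies outside [S :|: M], then [e] crosses that set and the deletion branch applies. *)
have [vU | vU] := boolP (v \in S :|: M).
  have [||||T TL [cT UT leT]] := L2P (S :|: M) => //.
  - by rewrite subUset sub1set vU subsetUr.
  - exact: leq_trans leU Sp.
  - exact: connected_fromW (subsetUr _ _) conU.
  exists T; first by rewrite mem_cat TL orbT.
  by split=> //; [apply: subset_trans (subsetUl _ _) UT | apply: leq_trans leT leU].
have eU : e \in boundary (S :|: M).
  have uU u : u \in M -> u \in S :|: M by rewrite inE orbC => ->.
  move: eB vU; rewrite /v !in_set; case sM: (src e \in M); case dM: (dst e \in M) => //= _.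
    by rewrite ?dM orbT orbF => /negPf ->.
  by rewrite ?sM orbT orbF => /negPf ->.
have eHU : e \in cut H (S :|: M) by rewrite inE eU.
have cutU := cutD1 eHU.
have [||||T TL [cT UT leT]] := L1P (S :|: M) => //.
- exact: subsetUr.
- by move: cutU leU Sp; clear; lia.
- exact: connected_fromD1.
exists T; first by rewrite mem_cat TL.
split=> //; first exact: subset_trans (subsetUl _ _) UT.
by have := cut_cardD1 H T e; move: leT cutU leU; clear; lia.
Qed.
End ImportantCuts.

(** * Sparse random subsets *)

(** As the first two terms vanish, the sum is at most [Q / 4 + Q / 8 + ...]. *)
Lemma geometric_sum_bound (t : nat -> nat) Q m : t 0 = 0 -> t 1 = 0 ->
  (forall r, 2 ^ r * t r <= Q) -> 2 * \sum_(r < m.+2) t r <= Q.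
Proof.
move=> t0 t1 tQ.
(* The partial sum is at most [Q / 2 - Q / 2 ^ m.+1]; denominators are cleared. *)
have claim : 2 ^ m.+1 * (\sum_(r < m.+2) t r) + Q <= 2 ^ m * Q.
  elim: m => [|m IHm]; first by rewrite !big_ord_recr big_ord0 /= t0 t1; lia.
  rewrite big_ord_recr /=; move: IHm (tQ m.+2); rewrite !expnS.
  by move: (2 ^ m) (\sum_(_ < _) _) (t _) => p s u; clear; nia.
have := expn_gt0 2 m; rewrite /= => pm.
by rewrite -(@leq_pmul2l (2 ^ m)) // mulnA -expnSr; apply: leq_trans (leq_addr Q _) claim.
Qed.

Section SparseSubset.
Variables (V : finType) (X : {set V}) (bad : V -> {set {set V}}) (a : nat).
Hypothesis a_gt0 : 0 < a.
Hypothesis bad_mem : forall x T, x \in X -> T \in bad x -> x \in T /\ 2 <= #|T|.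
Hypothesis bad_card : forall x r, x \in X -> #|[set T in bad x | #|T| == r]| <= a ^ r.

(** The square of [2 * a]: it gives [(2 * a) ^ r <= q ^ r.-1] for [r >= 2], so that the weights of
    bad sets decay geometrically. *)
Let q := 4 * a ^ 2.
Let q_gt0 : 0 < q. Proof. by rewrite muln_gt0 expn_gt0 a_gt0. Qed.

(** Scaled by the number [q ^ #|V|] of colorings: the expected number of bad sets at [x] entirely of
    color zero is at most half the probability [1 / q] that [x] has color zero. *)
Lemma bad_weight x : x \in X -> 2 * \sum_(T in bad x) q ^ (#|V| - #|T|) <= q ^ #|V|.-1.
Proof.
move=> xX; pose t r := #|[set T in bad x | #|T| == r]| * q ^ (#|V| - r).
have small r : #|[set T in bad x | #|T| == r]| != 0 -> 2 <= r <= #|V|.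
  rewrite cards_eq0 => /set0Pn[T]; rewrite inE => /andP[Tb /eqP <-].
  by rewrite (bad_mem xX Tb).2 max_card.
rewrite (_ : \sum_(T in _) _ = \sum_(r < #|V|.+2) t r).
  apply: geometric_sum_bound => [||r]; rewrite /t.
  - by case: eqP (small 0) => [-> //|_ /(_ isT)].
  - by case: eqP (small 1) => [-> //|_ /(_ isT)].
  case: eqP (small r) (bad_card r xX) => [-> | _ /(_ isT)/andP[r2 rV] le].
    by rewrite mul0n muln0.
  have -> : #|V|.-1 = (r.-1) + (#|V| - r) by lia.
  rewrite expnD mulnA leq_mul2r; apply/orP; right.
  apply: (@leq_trans ((2 * a) ^ r)); first by rewrite expnMn leq_mul2l le orbT.
  have -> : q = (2 * a) ^ 2 by rewrite expnMn.
  by rewrite -expnM leq_pexp2l //; lia.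
rewrite (partition_big (fun T : {set V} => inord #|T| : 'I_#|V|.+2) xpredT) //=.
apply: eq_bigr => r _; rewrite /t -sum1dep_card big_distrl /=.
apply: eq_big => [T | T /andP[_ /eqP <-]].
  by rewrite -val_eqE /= inordK // ltnS (leq_trans (max_card _)).
by rewrite mul1n inordK // ltnS (leq_trans (max_card _)).
Qed.

Let q1 := q.-1.
Notation coloring := {ffun V -> 'I_q1.+1}.
Let zero (f : coloring) : {set V} := [set x | f x == ord0].

Lemma card_zero_sup (T : {set V}) : #|[set f | T \subset zero f]| = q ^ (#|V| - #|T|).
Proof.
have -> : #|[set f | T \subset zero f]| = #|pffun_on (ord0 : 'I_q1.+1) (mem (~: T)) (mem 'I_q1.+1)|.
  apply: eq_card => f; rewrite inE; apply/subsetP/pffun_onP => [Tz | [sT _] x xT].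
    split=> //; apply/subsetP => x; rewrite !inE; apply: contra => /Tz; by rewrite inE.
  rewrite inE; apply: contraTT xT => fx.
  by have := subsetP sT x; rewrite !inE => /(_ fx).
by rewrite card_pffun_on card_ord prednK // -(cardsC T) addKn.
Qed.

(* A uniformly random coloring with [q] colors, from
   whose first color class the vertices of the few monochromatic bad sets are
   deleted. *)
Lemma sparse_subset : exists2 B : {set V}, B \subset X &
  #|X| <= 2 * q * #|B| /\ forall x T, x \in B -> T \in bad x -> ~~ (T \subset B).
Proof.
have [-> | [x0 x0X]] := set_0Vmem X.
  by exists set0 => //; split=> [|x T]; rewrite ?cards0 // inE.
have V_gt0 : 0 < #|V| by apply/card_gt0P; exists x0.
pose A f := X :&: zero f.
pose D f := [set x in A f | [exists (T | T \in bad x), T \subset zero f]].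
have DA f : D f \subset A f by apply/subsetP => x; rewrite inE => /andP[].
have sumA : \sum_f #|A f| = #|X| * q ^ #|V|.-1.
  under eq_bigr do rewrite -sum1_card big_mkcond /=.
  rewrite exchange_big /= -sum_nat_const [RHS]big_mkcond /=; apply: eq_bigr => x _.
  under eq_bigr do rewrite inE; case: (x \in X) => /=; last by rewrite big1.
  rewrite -subn1 -[X in _ - X](cards1 x) -card_zero_sup -sum1dep_card [RHS]big_mkcond.
  by apply: eq_bigr => f _; rewrite sub1set inE.
have sumD : 2 * \sum_f #|D f| <= \sum_f #|A f|.
  rewrite sumA -sum_nat_const.
  apply: (@leq_trans (\sum_(x in X) 2 * \sum_(T in bad x) q ^ (#|V| - #|T|))); last first.
    by apply: leq_sum => x; apply: bad_weight.
  rewrite -big_distrr /= leq_mul2l /=.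
  under [X in _ <= X]eq_bigr do under eq_bigr do rewrite -card_zero_sup -sum1dep_card big_mkcond.
  under [X in _ <= X]eq_bigr do rewrite exchange_big.
  rewrite [X in _ <= X]exchange_big; apply: leq_sum => f _ /=.
  rewrite -sum1_card big_mkcond [X in _ <= X]big_mkcond; apply: leq_sum => x _ /=.
  rewrite !inE; case: (x \in X) => //=; case: (_ == _) => //=.
  case: ifP => // /existsP[T /andP[Tb Tz]].
  by rewrite (bigD1 T) //= Tz leq_addr.
(* Averaging: the sets [A f :\: D f] have total size at least half of [#|X| * q ^ #|V|.-1], over
   [q ^ #|V|] colorings. *)
have [f fX] : exists f, #|X| <= 2 * q * #|A f :\: D f|.
  apply/existsP; apply: contraT; rewrite negb_exists => /forallP none.
  have : \sum_f (2 * q * #|A f| + 1) <= \sum_f (#|X| + 2 * q * #|D f|).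
    apply: leq_sum => f _; have := none f; rewrite -ltnNge cardsD (setIidPr (DA f)).
    by have := subset_leq_card (DA f); clear; nia.
  have cardf : #|{: coloring}| = q ^ #|V| by rewrite card_ffun card_ord (prednK q_gt0).
  rewrite !big_split /= -!big_distrr /= !sum_nat_const !cardf muln1 => le.
  have qV : q ^ #|V| = q * q ^ #|V|.-1 by rewrite -expnS prednK.
  have qV_gt0 : 0 < q ^ #|V| by rewrite expn_gt0 q_gt0.
  move: sumD le; rewrite sumA [X in _ + _ <= X + _]mulnC qV in qV_gt0 *.
  move: (\sum_f _) qV_gt0 => d; move: (q ^ _) (#|X|) => b n; clear; nia.
exists (A f :\: D f); first by apply: subset_trans (subsetDl _ _) (subsetIl _ _).
split=> // x T; rewrite inE => /andP[xD xA] Tb; apply: contra xD => TB.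
rewrite inE xA; apply/existsP; exists T; rewrite Tb.
by apply: subset_trans TB (subset_trans (subsetDl _ _) (subsetIr _ _)).
Qed.
End SparseSubset.

(** * Subsets satisfying the cut condition for [k] walks per vertex *)

Lemma card_subsets_of_seq (V : finType) (L : seq {set V}) m :
    {in L, forall S : {set V}, #|S| <= m} ->
  #|[set T : {set V} | has (fun S : {set V} => T \subset S) L]| <= size L * 2 ^ m.
Proof.
elim: L => [_|S L IHL small].
  by rewrite (_ : [set _ | _] = set0) ?cards0 //; apply/setP => T; rewrite !inE.
rewrite (_ : [set _ | _] =
    powerset S :|: [set T : {set V} | has (fun S : {set V} => T \subset S) L]); last first.
  by apply/setP => T; rewrite !inE.
rewrite mulSn; apply: leq_trans (leq_card_setU _ _) (leq_add _ _).
  by rewrite card_powerset leq_pexp2l // small ?inE ?eqxx.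
by apply: IHL => T TL; apply: small; rewrite inE TL orbT.
Qed.

Section FeasibleSubset.
Variables (G : mgraph) (c : vertex G) (Z : {set vertex G}) (k : nat) (H : {set edge G}).
Implicit Types (S T : {set vertex G}).
Hypothesis k_gt0 : 0 < k.
Hypothesis conH : cut_connected c Z k H.
Hypothesis linkH : forall S, c \notin S -> #|Z :&: S| <= #|cut H S|.

(** The obstructions fed to [sparse_subset]: sets whose joint demand of [k] walks per vertex exceeds
    the cut of a set connected from [x]. *)
Definition crowded_sets x : {set {set vertex G}} :=
  [set T : {set vertex G} | [&& T \subset Z, x \in T, 2 <= #|T| &
    [exists S : {set vertex G}, [&& c \notin S, T \subset S,
      connected_from H [set x] S & #|cut H S| < k * #|T|]]]].

(** A crowded set of size [r] lies in the trace on [Z] of one of at most [4 ^ (k * r)] important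
    cuts; by [linkH] such a trace has at most [k * r] vertices, hence at most [2 ^ (k * r)]
    subsets. *)
Lemma crowded_card x r : x \in Z ->
  #|[set T in crowded_sets x | #|T| == r]| <= (8 ^ k) ^ r.
Proof.
move=> xZ; have pot S : [set x] \subset S -> c \notin S ->
    2 * (k * r) <= 2 * (k * r) + #|cut H S| by rewrite leq_addr.
have [L [szL LP]] := important_cuts pot.
pose L' := [seq Z :&: A | A : {set vertex G} <- L & (c \notin A) && (#|cut H A| <= k * r)].
have small : {in L', forall S : {set vertex G}, #|S| <= k * r}.
  move=> _ /mapP[S + ->]; rewrite mem_filter => /andP[/andP[cS le] _].
  exact: leq_trans (linkH cS) le.
have -> : (8 ^ k) ^ r = 2 ^ (2 * (k * r)) * 2 ^ (k * r).
  by rewrite -(expnM 8) -[8]/(2 ^ 3) -expnM -expnD; congr (_ ^ _); lia.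
apply: leq_trans (leq_trans (card_subsets_of_seq small) _); last first.
  by rewrite leq_mul2r (leq_trans _ szL) ?orbT // size_map size_filter count_size.
apply/subset_leq_card/subsetP => T; rewrite !inE => /andP[/and4P[TZ xT _ /existsP[S HS]] /eqP Tr].
move: HS => /and4P[cS TS conS]; rewrite Tr => ltS; apply/hasP.
have [||S' S'L [cS' SS' le]] := LP S _ cS _ conS.
- by rewrite sub1set (subsetP TS).
- exact: ltnW.
exists (Z :&: S'); last by rewrite subsetI TZ (subset_trans TS).
apply/mapP; exists S' => //; rewrite mem_filter cS' S'L (leq_trans le) //=.
exact: ltnW.
Qed.

Lemma cut_split S T : T \subset S -> inner_edges H T (S :\: T) = set0 ->
  #|cut H T| + #|cut H (S :\: T)| = #|cut H S|.
Proof.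
move=> TS E; rewrite !card_cut -big_split; apply: eq_bigr => e eH /=.
have nE : e \notin inner_edges H T (S :\: T) by rewrite E inE.
have inner u v : joins e u v -> ~~ ((u \in T) && (v \in S :\: T)).
  move=> je; apply: contra nE => /andP[uT vT]; rewrite inE eH; apply/existsP; exists u.
  by rewrite uT; apply/existsP; exists v; rewrite vT.
have sub u : (u \in T) ==> (u \in S) by apply/implyP/(subsetP TS).
have := inner (src e) (dst e); have := inner (dst e) (src e).
rewrite [joins _ (dst e) _]joinsC joins_ends !inE => /(_ isT) + /(_ isT).
have := sub (src e); have := sub (dst e).
by case: (src e \in T); case: (dst e \in T); case: (src e \in S); case: (dst e \in S).
Qed.

(* A smallest set [S] violating the conclusion is connected, so its trace on [B]
   would be one of the crowded sets avoided by [B]. *)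
Lemma feasible_subset : exists2 B : {set vertex G}, B \subset Z &
  #|Z| <= 2 * (4 * (8 ^ k) ^ 2) * #|B| /\
  forall S, c \notin S -> k * #|B :&: S| <= #|cut H S|.
Proof.
have [|x T _ Tb|x r|B BZ [szB Bb]] := @sparse_subset _ Z crowded_sets (8 ^ k).
- by rewrite expn_gt0.
- by move: Tb; rewrite inE => /and4P[].
- exact: crowded_card.
exists B => //; split=> // S; have [n] := ubnP #|S|; elim: n S => // n IHn S ltSn cS.
rewrite leqNgt; apply/negP => lt.
have /set0Pn[x] : B :&: S != set0 by apply: contraTneq lt => ->; rewrite cards0 muln0.
rewrite inE => /andP[xB xS]; have xZ := subsetP BZ x xB.
(* A single vertex is already covered by [conH]. *)
have ge2 : 2 <= #|B :&: S|.
  rewrite ltnNge; apply/negP => le1.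
  have nZ : Z :&: S != set0 by apply/set0Pn; exists x; rewrite inE xZ.
  have := leq_trans lt (leq_mul (leqnn k) le1).
  by rewrite muln1 ltnNge conH.
have := Bb x (B :&: S) xB; rewrite subsetIl => /(_ _)/negP; apply=> //.
rewrite inE (subset_trans (subsetIl _ _)) //= inE xB xS ge2 /=; apply/existsP; exists S.
(* If [S] split into two parts with no edge between them, the inequalities for these smaller sets
   would add up to the one for [S]. *)
rewrite cS subsetIr lt andbT /=; apply/connected_fromP => T; rewrite sub1set => xT TS E.
apply/eqP; rewrite eqEsubset TS /= -setD_eq0 -cards_eq0; apply/negPn/negP => nT.
have splitS := cut_split TS E.
have cT : c \notin T by apply: contra cS; apply: (subsetP TS).
have cST : c \notin S :\: T by rewrite inE negb_and cS orbT.
have T_gt0 : 0 < #|T| by apply/card_gt0P; exists x.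
have szS : #|S| = #|T| + #|S :\: T| by rewrite -(cardsID T S) (setIidPr TS).
have szB' : #|B :&: S| = #|B :&: T| + #|B :&: (S :\: T)|.
  by rewrite -(cardsID T (B :&: S)) -setIA (setIidPr TS) setIDA.
have := IHn T _ cT; have := IHn (S :\: T) _ cST.
move: lt splitS nT T_gt0 szS ltSn; rewrite szB' mulnDr; clear; lia.
Qed.
End FeasibleSubset.

(** * Constants and conclusion *)

Lemma d_lower_bound k : 0 < k -> 16 * k * (8 ^ k) ^ 2 <= d k.
Proof.
move=> k0; rewrite /d -[X in _ <= X]mulnA [X in X <= _]mulnAC; apply: leq_mul; last first.
  by rewrite expnS -mulnA leq_pmulr // muln_gt0 expn_gt0 k0 addn1.
have -> : 16 * (8 ^ k) ^ 2 = 2 ^ (6 * k + 4).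
  by rewrite -[8]/(2 ^ 3) -[16]/(2 ^ 4) -!expnM -expnD; congr (_ ^ _); lia.
apply: (@leq_trans (2 ^ (8 * k + 4))); first by rewrite leq_pexp2l //; lia.
by rewrite leq_exp2r; lia.
Qed.

Theorem theorem5 (k : nat) (hk : 3 <= k) (G : mgraph) (c : vertex G)
  (X : {set vertex G}) (hX : X \subset [set~ c])
  (hcut : ~ exists (C : {set edge G}) (x : vertex G),
      [/\ x \in X, edge_cut_separating C c x & #|C| < k])
  (F : mgraph) (hdeg : forall v : vertex F, degree v <= k)
  (hF : ~ appears_as_strong_immersion F G) :
  exists (Y : {set vertex G}) (K : {set edge G}),
    [/\ Y \subset X,
        k * #|Y| + #|K| < d k * #|vertex F|
      & [disjoint component (del Y K) c & X]].
Proof.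
have k_gt0 : 0 < k by apply: leq_trans hk.
have cX : c \notin X by apply/negP => /(subsetP hX); rewrite !inE eqxx.
have [Z ZX [[Y [K [YX YK disj]]] [Q [linkQ Q1]]]] := linked_subset cX k_gt0.
have [small | large] := ltnP (k * #|Z|) (d k * #|vertex F|).
  by exists Y, K; split=> //; apply: leq_ltn_trans YK small.
case: hF.
have cZ : c \notin Z by apply: contra cX; apply: (subsetP ZX).
have conT : cut_connected c Z k setT.
  move=> S cS /set0Pn[x]; rewrite inE => /andP[xZ xS]; rewrite leqNgt; apply/negP => lt.
  apply: hcut; exists (boundary S), x; split.
  - exact: subsetP ZX x xZ.
  - exists (~: S); rewrite !inE cS negbK xS; split=> //.
    by apply/setP => e; rewrite !inE; do 2!case: (_ \in S).
  - by move: lt; rewrite /cut setIT.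
have [H [QH conH ZW]] := minimal_subgraph cZ k_gt0 conT Q1.
set W := tight_vertices c Z k H in ZW.
have WZ : W \subset Z by apply/subsetP => y; rewrite inE => /andP[].
have conW : cut_connected c W k H.
  move=> S cS /set0Pn[x]; rewrite inE => /andP[xW xS]; apply: conH => //.
  by apply/set0Pn; exists x; rewrite inE (subsetP WZ).
have linkW (S : {set vertex G}) : c \notin S -> #|W :&: S| <= #|cut H S|.
  move=> cS; apply: leq_trans (subset_leq_card (setSI S WZ)) _.
  by apply: leq_trans (linkQ S cS) (subset_leq_card (setIS _ QH)).
have [B BW [szB feB]] := feasible_subset k_gt0 conW linkW.
(* The factor [16 * k * (8 ^ k) ^ 2] collects [k] from [k * #|Z|], 2 from passing to tight vertices,
   and [8 * (8 ^ k) ^ 2] from the sparse subset. *)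
have FB : #|vertex F| <= #|B|.
  have d_gt0 : 0 < d k.
    by apply: leq_trans (d_lower_bound k_gt0); rewrite !muln_gt0 k_gt0 !expn_gt0.
  rewrite -(leq_pmul2l d_gt0); apply: leq_trans large _.
  apply: leq_trans (leq_mul (d_lower_bound k_gt0) (leqnn _)).
  move: ZW szB; move: (8 ^ k) => a; clear; move: #|Z| #|W| #|B| => z w b; nia.
(* The default [c] is never returned, since [B] has at least as many elements as [F] has
   vertices. *)
pose thV (v : vertex F) := nth c (enum B) (enum_rank v).
have szv (v : vertex F) : enum_rank v < size (enum B) by rewrite -cardE (leq_trans (ltn_ord _)).
have thB v : thV v \in B by rewrite -mem_enum mem_nth.
have thV_inj : injective thV.
  move=> u v /eqP; rewrite nth_uniq ?enum_uniq // => /eqP /val_inj.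
  exact: enum_rank_inj.
apply: (@strong_immersion_of_cuts k G F c H thV) => // [v | S cS | v].
- by apply: contraNneq cZ => <-; apply: (subsetP WZ); apply: (subsetP BW).
- apply: leq_trans (feB S cS); rewrite leq_mul2l -(card_imset _ thV_inj).
  apply/orP; right; apply/subset_leq_card/subsetP => _ /imsetP[v + ->].
  by rewrite !inE thB.
- have := subsetP BW _ (thB v); rewrite inE => /andP[_ /existsP[S /andP[+ vS]]].
  by move=> /and3P[cS _ /eqP eS]; exists S; rewrite eS.
Qed.
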